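(* Let $r,c\ge 1$ and $m\ge 0$ be integers. If $T(r,c,m)>0$, then $m\equiv rc \pmod 2$ and $m\le\max(r+1,c+1)$.
   Context: A tatami tiling of the $r\times c$ rectangular grid (with $r$ rows and $c$ columns of unit squares) is a tiling of the grid by monomers ($1\times 1$ tiles) and dimers ($1\times 2$ or $2\times 1$ tiles, horizontal or vertical) such that no point is a corner of four distinct tiles. $T(r,c,m)$ denotes the number of tatami tilings of the $r\times c$ grid that use exactly $m$ monomers. *)

(* Defs.v *)
From mathcomp Require Import all_boot.
Set Implicit Arguments. Unset Strict Implicit. Unset Printing Implicit Defensive.

Definition cell (r c : nat) : finType := ('I_r * 'I_c)%type.

Section Tatami.
Variables r c : nat.

Definition adjacent (x y : cell r c) : bool :=
  ((x.1 == y.1 :> nat) && ((x.2.+1 == y.2 :> nat) || (y.2.+1 == x.2 :> nat))) ||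
  ((x.2 == y.2 :> nat) && ((x.1.+1 == y.1 :> nat) || (y.1.+1 == x.1 :> nat))).

Definition monomer (B : {set cell r c}) : bool := #|B| == 1.

Definition is_tile (B : {set cell r c}) : bool :=
  monomer B || [exists x, exists y, adjacent x y && (B == [set x; y])].

Definition tiling (P : {set {set cell r c}}) : bool :=
  partition P [set: cell r c] && [forall B in P, is_tile B].

(* No interior grid point is a corner of four distinct tiles.  The interior
   point shared by cells a = (i,j), (i,j+1), (i+1,j), b = (i+1,j+1) is a corner
   of four distinct tiles iff these four cells lie in four distinct tiles. *)
Definition tatami_cond (P : {set {set cell r c}}) : bool :=
  [forall a : cell r c, forall b : cell r c,
     ((a.1.+1 == b.1 :> nat) && (a.2.+1 == b.2 :> nat)) ==>
     ~~ uniq [:: pblock P a; pblock P (a.1, b.2); pblock P (b.1, a.2); pblock P b]].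

Definition tatami (P : {set {set cell r c}}) : bool := tiling P && tatami_cond P.

Definition num_monomers (P : {set {set cell r c}}) : nat := #|[set B in P | monomer B]|.

End Tatami.

Definition T (r c m : nat) : nat :=
  #|[set P : {set {set cell r c}} | tatami P && (num_monomers P == m)]|.

(* Main.v *)
Require Import Defs.
From mathcomp Require Import all_boot zify.
Set Implicit Arguments. Unset Strict Implicit. Unset Printing Implicit Defensive.

(** Let [N] be the number of dimers, so that [m = rc - 2N]; parity is clear, and
    the bound [rc <= 2N + max(r,c) + 1] is proved by induction on [r + c] for
    [r <= c]: a rectangular piece of a tatami tiling, with cut dimers turned
    into monomers, is again a tatami tiling.

    Deleting the left column removes (#monomers) - (#horizontal dimer ends) of
    that column from [m].  Two monomers of a side with only dimers along the
    side between them (a "vee") force two diagonal rays, each having horizontal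
    dimers on one side and vertical dimers on the other.  An upward and a
    downward ray from the same side meet in a conflict unless their starting rows
    have different parities, and therefore the loss is at most 2 on a shorter
    side; on perpendicular sides, vees that are close enough always conflict.

    If [r < c] and one of them is odd, this and parity suffice.  If both are
    even, either [2r <= c] and one cuts the grid into an [r x r] and an
    [r x (c - r)] part, or a counterexample has vees on the left, right and top
    sides, and two of these conflict.  In an odd square, a counterexample has a
    dimer in each corner; say the top left one is vertical.  Then the top has a
    vee, hence the left side has none; so its outermost cells not in vertical
    dimers are monomers, which emit conflicting rays. *)

(** * Tatami tilings described by their dimers *)

(* [h x y] is the dimer on (x,y),(x,y+1) and [v x y] the one on (x,y),(x+1,y),
   row index first; [vertex_cover] is the tatami condition, stating that every
   interior grid point is the midpoint of a long side of some dimer. *)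
Record edges r c (h v : nat -> nat -> bool) : Prop := Edges {
  h_dom : forall x y, h x y -> x < r /\ y.+1 < c;
  v_dom : forall x y, v x y -> x.+1 < r /\ y < c;
  hh_disj : forall x y, h x y -> h x y.+1 -> False;
  vv_disj : forall x y, v x y -> v x.+1 y -> False;
  hv_disj00 : forall x y, h x y -> v x y -> False;
  hv_disj01 : forall x y, h x y -> v x y.+1 -> False;
  hv_disj10 : forall x y, h x.+1 y -> v x y -> False;
  hv_disj11 : forall x y, h x.+1 y -> v x y.+1 -> False;
  vertex_cover : forall x y, x.+1 < r -> y.+1 < c ->
    [\/ h x y, h x.+1 y, v x y | v x y.+1]
}.

Definition ndimers r c (h v : nat -> nat -> bool) :=
  \sum_(x < r) \sum_(y < c) (h x y + v x y).

Definition side_mono (h v : nat -> nat -> bool) x :=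
  [&& ~~ h x 0, ~~ v x 0 & ~~ ((0 < x) && v x.-1 0)].

Definition consecutive (a b : pred nat) i j :=
  [/\ i < j, a i, a j & forall k, i < k < j -> ~~ a k && ~~ b k].

Definition vee r (h v : nat -> nat -> bool) i j :=
  j < r /\ consecutive (side_mono h v) (h^~ 0) i j.

(** * Rays, runs and vees on the left side *)

Section LeftSide.
Variables (r c : nat) (h v : nat -> nat -> bool).
Hypothesis E : edges r c h v.
Local Notation M := (side_mono h v).

(* Row [k.+1] holds a monomer and the cell above it is not the end of a
   horizontal dimer; the ray descends to the right from there. *)
Lemma down_ray k t :
  M k.+1 -> ~~ h k 0 -> k.+1 + t < r -> t.+1 < c ->
  v (k + t) t.+1 /\ (k.+2 + t < r -> h (k.+2 + t) t).
Proof.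
case/and3P => /negP Mh /negP Mv /= /negP Mu /negP Hk.
elim: t => [|t IH] Hr Hc.
  rewrite !addn0 in Hr *.
  (* At the upper right corner of the monomer, [v k 1] is the only cover left; every later grid
     point on the ray is settled by the same elimination. *)
  have V : v k 1 by case: (vertex_cover E Hr Hc).
  split=> // Hr2.
  case: (vertex_cover E Hr2 Hc) => // V2.
  by case: (vv_disj E V V2).
have [||V /(_ _) H] := IH; try lia.
have {}H : h (k.+2 + t) t by apply: H; lia.
have V' : v (k + t).+1 t.+2.
  have [||X|X|X|X] := @vertex_cover _ _ _ _ E (k + t).+1 t.+1; [lia|lia|try by []..].
  - by case: (hv_disj10 E X V).
  - by case: (hh_disj E H X).
  - by case: (vv_disj E V X).
rewrite addnS; split=> // Hr2.
have [||X|X|X|X] := @vertex_cover _ _ _ _ E (k.+2 + t) t.+1; [lia|lia|try by []..].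
- by case: (hh_disj E H X).
- by rewrite addnS.
- by case: (hv_disj01 E H X).
- by case: (vv_disj E V' X).
Qed.

(** Mirror image of [down_ray]: the ray climbs to the right, and [t < i] says that a row remains
    above it. *)
Lemma up_ray i t :
  M i -> i.+1 < r -> ~~ h i.+1 0 -> t <= i -> t.+1 < c ->
  v (i - t) t.+1 /\ (t < i -> h (i.-1 - t) t).
Proof.
case/and3P => /negP Mh /negP Mv /negP Mu Hr /negP Hk.
elim: t => [|t IH] Ht Hc.
  rewrite !subn0.
  have V : v i 1 by case: (vertex_cover E Hr Hc).
  split=> // i0; case: i i0 Mh Mv Mu Hr Hk V {Ht} => // i _ /= Mh Mv Mu Hr Hk V.
  have [||X|X|X|X] := @vertex_cover _ _ _ _ E i 0; [lia|lia|by []|by []|by []|by case: (vv_disj E X V)].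
have [||V H] := IH; try lia.
have {}H : h (i.-1 - t) t by apply: H.
have [k def_i] : {k | i = k + t.+1} by exists (i - t.+1); lia.
have e1 : i - t = k.+1 by lia. have e2 : i.-1 - t = k by lia.
rewrite {}e1 {}e2 in V H.
have -> : i - t.+1 = k by lia. have -> : i.-1 - t.+1 = k.-1 by lia.
have V' : v k t.+2.
  have [||X|X|X|X] := @vertex_cover _ _ _ _ E k t.+1; [lia|lia|try by []..].
  - by case: (hh_disj E H X).
  - by case: (hv_disj00 E X V).
  - by case: (vv_disj E X V).
split=> // Hti; case: k V' H V def_i => [|k] V' H V def_i; first lia.
have [||X|X|X|X] := @vertex_cover _ _ _ _ E k t.+1; [lia|lia|try by []..].
- by case: (hh_disj E H X).
- by case: (hv_disj11 E H X).
- by case: (vv_disj E X V').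
Qed.

(* If the gap were even, the two rays would share a cell. *)
Lemma ray_parity k i :
  r <= c -> M k.+1 -> ~~ h k 0 -> M i -> i.+1 < r -> ~~ h i.+1 0 ->
  k < i -> odd (i - k.+1).
Proof.
move=> rc Mk hk Mi ir hi ki; apply/negPn/negP => ev.
pose s := (i - k.+1)./2.
have def_i : i = k.+1 + s + s by rewrite /s; lia.
have [||D _] := @down_ray k s Mk hk; try lia.
have [||U _] := @up_ray i s Mi ir hi; try lia.
have e : i - s = (k + s).+1 by lia.
by rewrite e in U; case: (vv_disj E D U).
Qed.

(* A cell of the left column is a monomer, the end of a horizontal dimer, or half of a vertical dimer; a run of the last kind pairs up. *)
Lemma vertical_run s k :
  (0 < s -> ~~ v s.-1 0) -> (forall x, s <= x < k -> ~~ M x && ~~ h x 0) ->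
  s <= k -> odd (k - s) -> v k.-1 0.
Proof.
move=> nb run sk.
(* No vertical dimer crosses the upper border of row [s + t.*2]: the cells of the run above it pair
   up among themselves. *)
have step t : s + t.*2 <= k -> (0 < s + t.*2 -> ~~ v (s + t.*2).-1 0).
  elim: t => [|t IH] Ht; first by rewrite addn0.
  move=> _; have Ht' : s + t.*2 < k by rewrite doubleS in Ht; lia.
  have /andP[nM nh] : ~~ M (s + t.*2) && ~~ h (s + t.*2) 0 by apply: run; lia.
  have V : v (s + t.*2) 0.
    move: nM; rewrite /side_mono nh /= negb_and !negbK => /orP[//|/andP[p V]].
    by have := IH _ p; rewrite V => /(_ (ltnW Ht')).
  apply/negP => V'; apply: (vv_disj E V).
  by have -> : (s + t.*2).+1 = (s + (t.+1).*2).-1 by lia.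
move=> od; pose t := (k - s)./2.
have def_k : k = (s + t.*2).+1 by rewrite /t; lia.
have Ht : s + t.*2 <= k by lia.
have /andP[nM nh] : ~~ M (s + t.*2) && ~~ h (s + t.*2) 0 by apply: run; lia.
rewrite def_k /=; move: nM; rewrite /side_mono nh /= negb_and !negbK => /orP[//|/andP[p V]].
by have := step t Ht p; rewrite V.
Qed.

(** Call rows [i] and [j] letters: their cells lie in no vertical dimer, so the cells strictly
    between them pair up and are even in number. *)
Lemma letter_gap i j :
  M i || h i 0 -> M j || h j 0 -> i < j ->
  (forall k, i < k < j -> ~~ M k && ~~ h k 0) -> odd (j - i).
Proof.
move=> Li Lj ij gap; apply/negPn/negP => ev.
have /negP[] : ~~ v j.-1 0.
  apply/negP => V; case/orP: Lj => [/and3P[_ _ /negP[]]|H]; first by rewrite V; lia.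
  by case: j ij V H {gap ev} => // j _ V H; case: (hv_disj10 E H V).
apply: (@vertical_run i.+1) => //; last lia.
move=> _; apply/negP => /= V; case/orP: Li => [/and3P[_ /negP//]|H].
by case: (hv_disj00 E H V).
Qed.

(** Supplies the hypotheses of [up_ray] at the upper end of a vee; [vee_lower] does the same for
    [down_ray] at the lower end. *)
Lemma vee_upper i j : vee r h v i j -> [/\ M i, i.+1 < r & ~~ h i.+1 0].
Proof.
case=> jr [ij Mi Mj gap]; split=> //; first lia.
case: (eqVneq i.+1 j) => [->|ne]; first by case/and3P: Mj.
by have /gap/andP[] : i < i.+1 < j by lia.
Qed.

Lemma vee_lower i j :
  vee r h v i j -> exists k, [/\ j = k.+1, i <= k, M k.+1 & ~~ h k 0].
Proof.
case=> jr [ij Mi Mj gap]; case: j jr ij Mj gap => // k jr ij Mj gap.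
exists k; split=> //; case: (eqVneq i k) => [<-|ne]; first by case/and3P: Mi.
by have /gap/andP[] : i < k < k.+1 by lia.
Qed.

(** For the higher vee, [j - i] is odd by [letter_gap]. The downward ray from [j] and the upward ray
    from [i'] make [i' - j] odd as well. *)
Lemma vee_parity i j i' j' :
  r <= c -> vee r h v i j -> vee r h v i' j' -> odd i = odd i'.
Proof.
move=> rc; wlog ii' : i j i' j' / i <= i'.
  by move=> W V V'; case: (leqP i i') => l; [|symmetry]; apply: W; eauto; lia.
move=> V V'; case: (eqVneq i i') => [-> //|ne].
have [Mi' ir' hi'] := vee_upper V'.
have [k [jk ik Mk hk]] := vee_lower V; case: V => jr [ij Mi Mj gap].
have ji' : j <= i'.
  rewrite leqNgt; apply/negP => l; have /gap : i < i' < j by lia.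
  by rewrite Mi'.
have o1 : odd (j - i) by apply: letter_gap => //; rewrite ?Mi ?Mj.
suff: odd (i' - j) by lia.
by rewrite jk; apply: ray_parity => //; lia.
Qed.

(** Count the cells of the left column by tile: a vertical dimer takes two of them, a horizontal
    dimer or a monomer takes one. *)
Lemma side_count :
  \sum_(x < r) M x + 2 * \sum_(x < r) (h x 0 + v x 0) = r + \sum_(x < r) h x 0.
Proof.
(* The last summand accounts for a vertical dimer that sticks out below the first [n] rows. *)
suff main n : n <= r ->
  \sum_(x < n) M x + 2 * \sum_(x < n) (h x 0 + v x 0) =
  n + \sum_(x < n) h x 0 + ((0 < n) && v n.-1 0).
  rewrite main //; suff -> : (0 < r) && v r.-1 0 = false by rewrite addn0.
  by apply/negP => /andP[p /(v_dom E)]; lia.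
elim: n => [|n IH] Hn; first by rewrite !big_ord0.
move/(_ (ltnW Hn)): IH; rewrite !big_ord_recr /=.
rewrite [M n]/side_mono.
case Hh: (h n 0); case Hv: (v n 0); case Hu : ((0 < n) && v n.-1 0) => /=; try lia.
- by case: (hv_disj00 E Hh Hv).
- by case: (hv_disj00 E Hh Hv).
- by case: n {Hn} Hh Hv Hu => [|n] //= Hh Hv Hu; case: (hv_disj10 E Hh Hu).
- by case: n {Hn} Hh Hv Hu => [|n] //= Hh Hv Hu; case: (vv_disj E Hu Hv).
Qed.
End LeftSide.

(** * Alternation of two kinds of letters in a word *)

Definition first_is (a b : pred nat) n :=
  exists j, [/\ j < n, a j & forall k, k < j -> ~~ a k && ~~ b k].
Definition last_is (a b : pred nat) n :=
  exists i, [/\ i < n, a i & forall k, i < k < n -> ~~ a k && ~~ b k].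

Lemma first_isS a b n : first_is a b n -> first_is a b n.+1.
Proof. by case=> j [jn aj H]; exists j; split=> //; lia. Qed.

(** If some [b] separates any two successive [a], then [a] can outnumber [b] by one at most, and
    only in a word that begins and ends with [a]. *)
Lemma no_consecutive_count (a b : pred nat) n :
  (forall x, a x -> b x -> False) ->
  (exists i j, j < n /\ consecutive a b i j) \/
  \sum_(x < n) a x <= (\sum_(x < n) b x).+1 /\
  (\sum_(x < n) a x <= \sum_(x < n) b x \/ first_is a b n /\ last_is a b n).
Proof.
move=> ab.
(* The invariant for the induction on [n] is split by the last letter so far: none, an [a], or a
   [b]. *)
suff: (exists i j, j < n /\ consecutive a b i j) \/
  [\/ [/\ forall k, k < n -> ~~ a k && ~~ b k,
        \sum_(x < n) a x = 0 & \sum_(x < n) b x = 0],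
      [/\ last_is a b n, \sum_(x < n) a x <= (\sum_(x < n) b x).+1 &
        \sum_(x < n) a x <= \sum_(x < n) b x \/ first_is a b n] |
      [/\ last_is b a n, \sum_(x < n) a x <= \sum_(x < n) b x &
        (\sum_(x < n) a x < \sum_(x < n) b x) \/ first_is a b n]].
  case=> H; [by left | right].
  case: H => [[_ -> ->] | [L l [H|H]] | [L l _]]; split=> //; try by left.
    by right.
  exact: leqW.
elim: n => [|n [[i [j [jn H]]]|IH]].
- by right; constructor 1; rewrite !big_ord0.
- by left; exists i, j; split=> //; lia.
have ext i (p q : pred nat) : (forall k, i < k < n -> ~~ p k && ~~ q k) ->
    ~~ p n -> ~~ q n -> forall k, i < k < n.+1 -> ~~ p k && ~~ q k.
  move=> H pn qn k Hk; case: (eqVneq k n) => [->|ne]; first by rewrite pn.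
  by apply: H; lia.
rewrite !big_ord_recr /=.
case an: (a n); case bn: (b n) => /=; rewrite ?addn0 ?addn1; first by case: (ab n).
- have La : last_is a b n.+1 by exists n; split=> // k; lia.
  case: IH => [[H -> ->]|[[i [ni ai H]] _ _]|[_ l F]].
  + right; constructor 2; split=> //; right; exists n; split=> //.
  + by left; exists i, n; split=> //; split.
  + right; constructor 2; split=> //.
    by case: F => F; [left | right; exact: first_isS].
- have Lb : last_is b a n.+1 by exists n; split=> // k; lia.
  right; constructor 3; case: IH => [[H -> ->]|[_ l F]|[_ l F]].
  + by split=> //; left.
  + by split=> //; case: F => F; [left | right; exact: first_isS].
  + split=> //; first exact: leqW.
    by case: F => F; [left; exact: leqW | right; exact: first_isS].
- right; case: IH => [[H -> ->]|[[i [ni ai H]] l F]|[[i [ni ai H]] l F]].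
  + constructor 1; split=> // k Hk; case: (eqVneq k n) => [->|ne]; first by rewrite an bn.
    by apply: H; lia.
  + constructor 2; split=> //; last by case: F => F; [left | right; exact: first_isS].
    by exists i; split=> //; [lia | apply: ext; rewrite ?an ?bn].
  + constructor 3; split=> //; last by case: F => F; [left | right; exact: first_isS].
    by exists i; split=> //; [lia | apply: ext; rewrite ?an ?bn].
Qed.

(** * Excess of monomers over horizontal dimer ends on a side *)

Section Excess.
Variables (r c : nat) (h v : nat -> nat -> bool).
Hypothesis E : edges r c h v.
Local Notation M := (side_mono h v).
Local Notation D := (h^~ 0).

Lemma mono_not_end x : M x -> h x 0 -> False.
Proof. by case/and3P => /negP. Qed.

Lemma vee_of_count :
  (exists i j, vee r h v i j) \/
  \sum_(x < r) M x <= (\sum_(x < r) h x 0).+1 /\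
  (\sum_(x < r) M x <= \sum_(x < r) h x 0 \/ first_is M D r /\ last_is M D r).
Proof.
case: (@no_consecutive_count M D r mono_not_end) => [[i [j V]]|]; last by right.
by left; exists i, j.
Qed.

(* Below a monomer that is not the upper end of a vee, the next cell outside
   vertical dimers is the end of a horizontal one, an odd number of rows away;
   this matches monomers of one row parity with dimers of the other. *)
Lemma parity_class_count b :
  (exists i j, vee r h v i j /\ odd i = ~~ b) \/
  \sum_(x < r) M x <= \sum_(x < r) h x 0 + 2.
Proof.
pose M1 := [pred x | M x & odd x == ~~ b]; pose D1 := [pred x | h x 0 & odd x == b].
pose M2 := [pred x | M x & odd x == b]; pose D2 := [pred x | h x 0 & odd x == ~~ b].
have disj (p q : pred nat) x : M x && p x -> h x 0 && q x -> False.
  by case/andP=> Mx _ /andP[Hx _]; exact: mono_not_end Mx Hx.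
have [[i [j [jr [ij /andP[Mi /eqP oi] /andP[Mj /eqP oj] gap]]]]|[H1 _]] :=
    @no_consecutive_count M1 D1 r (@disj _ _).
  left; have ex : exists k, (i < k) && (M k || h k 0) by exists j; rewrite ij Mj.
  (* The first letter [k] after [i] has parity [b], so it differs from [j] and lies in the gap. Not
     being in [D1], it is a monomer, and [i], [k] form a vee. *)
  case: (ex_minnP ex) => k /andP[ik Lk] kmin.
  have kj : k <= j by apply: kmin; rewrite ij Mj.
  have o : odd (k - i).
    apply: (letter_gap E) => //; first by rewrite Mi.
    move=> x /andP[ix xk]; rewrite -negb_or; apply/negP => Lx.
    by have := kmin x; rewrite ix Lx => /(_ isT); lia.
  have ok : odd k = b by lia.
  have kj' : k < j by rewrite ltn_neqAle kj andbT; apply/eqP => e; move: ok; rewrite e oj; case: (b).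
  have /andP[_ nD] := gap k ltac:(lia).
  have Mk : M k by move: nD Lk; rewrite /= ok eqxx andbT => /negbTE ->; rewrite orbF.
  exists i, k; split=> //; split; first lia.
  split=> // x /andP[ix xk]; rewrite -negb_or; apply/negP => Lx.
  by have := kmin x; rewrite ix Lx => /(_ isT); lia.
have [[i [j [jr [ij /andP[Mi /eqP oi] /andP[Mj /eqP oj] gap]]]]|[H2 _]] :=
    @no_consecutive_count M2 D2 r (@disj _ _).
  left; have ex : exists k, (k < j) && (M k || h k 0) by exists i; rewrite ij Mi.
  (* Now the last letter before [j] is taken, so that again the upper end of the vee has parity
     [~~ b]. *)
  have ub k : (k < j) && (M k || h k 0) -> k <= j by lia.
  case: (ex_maxnP ex ub) => k /andP[kj Lk] kmax.
  have ik : i <= k by apply: kmax; rewrite ij Mi.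
  have o : odd (j - k).
    apply: (letter_gap E) => //; first by rewrite Mj.
    move=> x /andP[kx xj]; rewrite -negb_or; apply/negP => Lx.
    by have := kmax x; rewrite xj Lx => /(_ isT); lia.
  have ok : odd k = ~~ b by lia.
  have ik' : i < k by rewrite ltn_neqAle ik andbT; apply/eqP => e; move: ok; rewrite -e oi; case: (b).
  have /andP[_ nD] := gap k ltac:(lia).
  have Mk : M k by move: nD Lk; rewrite /= ok eqxx andbT => /negbTE ->; rewrite orbF.
  exists k, j; split=> //; split=> //.
  split=> // x /andP[kx xj]; rewrite -negb_or; apply/negP => Lx.
  by have := kmax x; rewrite xj Lx => /(_ isT); lia.
right.
have -> : \sum_(x < r) M x = \sum_(x < r) M1 x + \sum_(x < r) M2 x.
  rewrite -big_split; apply: eq_bigr => x _ /=.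
  by case: (M x); case: (odd x); case: (b).
have -> : \sum_(x < r) h x 0 = \sum_(x < r) D1 x + \sum_(x < r) D2 x.
  rewrite -big_split; apply: eq_bigr => x _ /=.
  by case: (h x 0); case: (odd x); case: (b).
by move: H1 H2; set s1 := \sum_(x < r) M1 x; set s2 := \sum_(x < r) M2 x;
   set t1 := \sum_(x < r) D1 x; set t2 := \sum_(x < r) D2 x; lia.
Qed.

(** A larger excess would yield vees whose upper ends have both parities, against [vee_parity]. *)
Lemma excess_le2 : r <= c -> \sum_(x < r) M x <= \sum_(x < r) h x 0 + 2.
Proof.
move=> rc.
case: (parity_class_count true) => [[i [j [V oi]]]|//].
case: (parity_class_count false) => [[i' [j' [V' oi']]]|//].
by have := vee_parity E rc V V'; rewrite oi oi'.
Qed.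

(** These are the dimers lost when the left column is deleted, see [ndimers_shift]. *)
Definition side := \sum_(x < r) (h x 0 + v x 0).

Lemma side_ge : r <= c -> r <= 2 * side + 2.
Proof. by move=> rc; have := side_count E; have := excess_le2 rc; rewrite /side; lia. Qed.

(** By [side_count] the monomers exceed the horizontal ends by at least two, which is more than
    alternation allows. *)
Lemma vee_of_side : 2 * side + 2 <= r -> exists i j, vee r h v i j.
Proof.
have := side_count E; rewrite -/side => e s; case: vee_of_count => // -[].
by set x := \sum_(x < r) M x in e *; lia.
Qed.

Lemma vee_or_monomer_ends : 2 * side < r ->
  (exists i j, vee r h v i j) \/ first_is M D r /\ last_is M D r.
Proof.
have := side_count E; rewrite -/side => e s; case: vee_of_count; first by left.
by case=> _ []; [lia | right].
Qed.
End Excess.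

(** * Symmetries and cuts *)

Definition tr (f : nat -> nat -> bool) x y := f y x.

Lemma edges_tr r c h v : edges r c h v -> edges c r (tr v) (tr h).
Proof.
move=> E; split; rewrite /tr => x y.
- by case/(v_dom E).
- by case/(h_dom E).
- exact: (vv_disj E).
- exact: (hh_disj E).
- by move=> V H; exact: (hv_disj00 E H V).
- by move=> V H; exact: (hv_disj10 E H V).
- by move=> V H; exact: (hv_disj01 E H V).
- by move=> V H; exact: (hv_disj11 E H V).
- by move=> xr yc; case: (vertex_cover E yc xr) => X; [constructor 3|constructor 4|constructor 1|constructor 2].
Qed.

Lemma ndimers_tr r c h v : ndimers c r (tr v) (tr h) = ndimers r c h v.
Proof.
rewrite /ndimers exchange_big; apply: eq_bigr => x _; apply: eq_bigr => y _.
exact: addnC.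
Qed.

Section Flip.
Variables (c : nat) (h v : nat -> nat -> bool).
(** Left-right reflection. A horizontal dimer is indexed by its left cell, hence [c.-2] instead of
    [c.-1]. The guards stop truncated subtraction from creating dimers outside the grid. *)
Definition flip_h x y := (y.+1 < c) && h x (c.-2 - y).
Definition flip_v x y := (y < c) && v x (c.-1 - y).
End Flip.

Lemma edges_flip r c h v : edges r c h v -> edges r c (flip_h c h) (flip_v c v).
Proof.
move=> E; split; rewrite /flip_h /flip_v => x y.
- by case/andP=> yc /(h_dom E) [].
- by case/andP=> yc /(v_dom E) [].
- case/andP=> y1 H /andP[y2 H']; apply: (hh_disj E H'); suff <- : c.-2 - y = (c.-2 - y.+1).+1 by []; lia.
- by case/andP=> y1 V /andP[y2 V']; apply: (vv_disj E V V').
- case/andP=> y1 H /andP[y2 V]; apply: (hv_disj01 E H); suff <- : c.-1 - y = (c.-2 - y).+1 by []; lia.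
- case/andP=> y1 H /andP[y2 V]; apply: (hv_disj00 E H); suff <- : c.-1 - y.+1 = c.-2 - y by []; lia.
- case/andP=> y1 H /andP[y2 V]; apply: (hv_disj11 E H); suff <- : c.-1 - y = (c.-2 - y).+1 by []; lia.
- case/andP=> y1 H /andP[y2 V]; apply: (hv_disj10 E H); suff <- : c.-1 - y.+1 = c.-2 - y by []; lia.
- move=> xr yc; have yc' : (c.-2 - y).+1 < c by lia.
  have e1 : c.-1 - y = (c.-2 - y).+1 by lia. have e2 : c.-1 - y.+1 = c.-2 - y by lia.
  rewrite e1 e2 yc (ltnW yc).
  by case: (vertex_cover E xr yc') => X; [constructor 1|constructor 2|constructor 4|constructor 3].
Qed.

Lemma ndimers_flip r c h v : edges r c h v ->
  ndimers r c (flip_h c h) (flip_v c v) = ndimers r c h v.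
Proof.
move=> E; apply: eq_bigr => x _; rewrite !big_split /=; congr (_ + _).
  case: c E => [|d] E; first by rewrite !big_ord0.
  rewrite !big_ord_recr /= /flip_h ltnn /=.
  have -> : h x d = false by apply/negP => /(h_dom E); lia.
  congr (_ + _); rewrite (reindex_inj rev_ord_inj); apply: eq_bigr => y _ /=.
  have yd := ltn_ord y; have -> : (d - y.+1).+2 <= d.+1 by lia.
  by have -> : d.-1 - (d - y.+1) = y by lia.
rewrite (reindex_inj rev_ord_inj); apply: eq_bigr => y _ /=.
have yd := ltn_ord y; rewrite /flip_v; have -> : c - y.+1 < c by lia.
by have -> : c.-1 - (c - y.+1) = y by lia.
Qed.

Lemma mono_flip r c h v x : edges r c h v -> x < c ->
  side_mono (tr (flip_v c v)) (tr (flip_h c h)) x = side_mono (tr v) (tr h) (c.-1 - x).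
Proof.
move=> E xc; rewrite /side_mono /tr /flip_h /flip_v xc /=.
congr (_ && _); rewrite andbC; congr (~~ _ && ~~ _).
  case: x xc => [|x] xc /=.
    by symmetry; apply/negP => /(h_dom E); lia.
  by rewrite xc /=; congr h; lia.
by congr (_ && h _ _); lia.
Qed.

Lemma vee_flip r c h v p q : edges r c h v ->
  vee c (tr v) (tr h) p q ->
  vee c (tr (flip_v c v)) (tr (flip_h c h)) (c.-1 - q) (c.-1 - p).
Proof.
move=> E [qc [pq Mp Mq gap]]; split; first lia.
split; try by rewrite (mono_flip E); [congr side_mono|]; try lia.
- lia.
- rewrite (mono_flip E); last lia.
  by have -> : c.-1 - (c.-1 - q) = q by lia.
- rewrite (mono_flip E); last lia.
  by have -> : c.-1 - (c.-1 - p) = p by lia.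
- move=> k Hk; rewrite (mono_flip E); last lia.
  have /gap/andP[-> /=] : p < c.-1 - k < q by lia.
  rewrite /tr /flip_v; have -> : k < c by lia.
  by [].
Qed.

(** A dimer that covers an interior grid point of a piece lies wholly in that piece. So dropping the
    dimers cut by the border keeps [vertex_cover], here and in [edges_trunc]. *)
Lemma edges_shift r c j h v : edges r (j + c) h v ->
  edges r c (fun x y => h x (j + y)) (fun x y => v x (j + y)).
Proof.
move=> E; split=> x y; rewrite ?addnS.
- by case/(h_dom E); lia.
- by case/(v_dom E); lia.
- exact: (hh_disj E).
- exact: (vv_disj E).
- exact: (hv_disj00 E).
- exact: (hv_disj01 E).
- exact: (hv_disj10 E).
- exact: (hv_disj11 E).
- by move=> xr yc; apply: (vertex_cover E) => //; lia.
Qed.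

Lemma edges_trunc r c j h v : edges r (j + c) h v ->
  edges r j (fun x y => (y.+1 < j) && h x y) (fun x y => (y < j) && v x y).
Proof.
move=> E; split=> x y.
- by case/andP=> yj /(h_dom E) [].
- by case/andP=> yj /(v_dom E) [].
- by case/andP=> _ H /andP[_ H']; exact: (hh_disj E H H').
- by case/andP=> _ H /andP[_ H']; exact: (vv_disj E H H').
- by case/andP=> _ H /andP[_ H']; exact: (hv_disj00 E H H').
- by case/andP=> _ H /andP[_ H']; exact: (hv_disj01 E H H').
- by case/andP=> _ H /andP[_ H']; exact: (hv_disj10 E H H').
- by case/andP=> _ H /andP[_ H']; exact: (hv_disj11 E H H').
- move=> xr yc; rewrite yc (ltnW yc) /=.
  have yc' : y.+1 < j + c by lia.
  exact: (vertex_cover E xr yc').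
Qed.

Lemma ndimers_cut r c j h v :
  ndimers r j (fun x y => (y.+1 < j) && h x y) (fun x y => (y < j) && v x y) +
  ndimers r c (fun x y => h x (j + y)) (fun x y => v x (j + y)) <=
  ndimers r (j + c) h v.
Proof.
rewrite /ndimers -big_split; apply: leq_sum => x _ /=.
rewrite big_split_ord /= leq_add2r; apply: leq_sum => y _.
by case: (_ < _); case: (_ < _); case: (h _ _); case: (v _ _).
Qed.

Lemma ndimers_shift r c h v :
  ndimers r c.+1 h v =
  side r h v + ndimers r c (fun x y => h x y.+1) (fun x y => v x y.+1).
Proof.
by rewrite /ndimers /side -big_split; apply: eq_bigr => x _; rewrite big_ord_recl.
Qed.

(** * Conflicts between perpendicular sides *)

Section Crossing.
Variables (r c : nat) (h v : nat -> nat -> bool).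
Hypothesis E : edges r c h v.

(** If [i < q], the ray reaches the top row at column [i.+1], inside the vee or at its end [q]; if
    [q = i], a horizontal dimer of the ray covers the monomer at [q]. If [q < i], the ray crosses
    the one that leaves [q] to the right. *)
Lemma up_ray_top_vee i p q :
  side_mono h v i -> i.+1 < r -> ~~ h i.+1 0 -> i < c ->
  vee c (tr v) (tr h) p q -> p <= i -> False.
Proof.
move=> Mi ir hi ic V pi.
have [k [qk pk Mk vk]] := vee_lower V; case: V => qc [pq Mp Mq gap].
have up t := @up_ray _ _ _ _ E i t Mi ir hi.
case: (ltnP i q) => [iq|qi].
  have [||U _] := up i; try lia.
  rewrite subnn in U; case: (eqVneq i.+1 q) => [e|ne].
    by case/and3P: Mq => /negP[]; rewrite -e.
  have /gap/andP[_ /negP] : p < i.+1 < q by lia.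
  by [].
case: (eqVneq q i) => [e|ne].
  have [||_ H] := up i.-1; try lia.
  case/and3P: Mq => _ _ /negP[]; rewrite /tr e; apply/andP; split; first lia.
  by rewrite subnn in H; apply: H; lia.
have down t := @down_ray _ _ _ _ (edges_tr E) k t Mk vk.
(* Unlike rays from one side, these collide for either parity of [i - q]: a horizontal and a
   vertical dimer share the cell in column [(q + s).+1] of row [s], with [s] lowered by one in the
   even case and the row then being [s.+1]. *)
pose s := (i - q)./2.
case oi : (odd (i - q)).
  have def_i : i = (q + s + s).+1 by rewrite /s; lia.
  have [||_ H] := up (q + s); try lia.
  have {}H : h s (q + s).
    have e : i.-1 - (q + s) = s by lia.
    by rewrite e in H; apply: H; lia.
  have [||_ W] := down s; try lia.
  apply: (hv_disj01 E H); have -> : (q + s).+1 = k.+2 + s by lia.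
  by apply: W; lia.
have def_i : i = q + s + s by rewrite /s; lia.
have s0 : 0 < s by lia.
case: s def_i s0 => // s def_i _.
have [||_ H] := up (q + s); try lia.
have {}H : h s.+1 (q + s).
  have e : i.-1 - (q + s) = s.+1 by lia.
  by rewrite e in H; apply: H; lia.
have [||_ W] := down s; try lia.
apply: (hv_disj11 E H); have -> : (q + s).+1 = k.+2 + s by lia.
by apply: W; lia.
Qed.
End Crossing.

(** The conflict comes from the vee that starts farther from the common corner; transposition
    exchanges the two cases. *)
Lemma no_adjacent_vees r c h v i j p q : edges r c h v ->
  vee r h v i j -> vee c (tr v) (tr h) p q -> i < c -> p < r -> False.
Proof.
move=> E V W ic pr; case: (leqP p i) => [pi|/ltnW ip].
  have [Mi ir hi] := vee_upper V.
  exact: (up_ray_top_vee E Mi ir hi ic W pi).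
have [Mp pc vp] := vee_upper W.
exact: (up_ray_top_vee (edges_tr E) Mp pc vp pr V ip).
Qed.

(** * The induction on the size of the grid *)

Definition dimer_bound r c := forall h v, edges r c h v ->
  r * c <= 2 * ndimers r c h v + (maxn r c).+1.

Lemma dimer_bound_tr r c : dimer_bound r c -> dimer_bound c r.
Proof.
move=> B h v E; have := B _ _ (edges_tr E).
by rewrite ndimers_tr mulnC maxnC.
Qed.

Lemma edges_behead r c h v : edges r c.+1 h v ->
  edges r c (fun x y => h x y.+1) (fun x y => v x y.+1).
Proof. exact: (@edges_shift r c 1). Qed.

Lemma drop_column r c h v : dimer_bound r c -> edges r c.+1 h v ->
  r * c.+1 + 2 * side r h v <= 2 * ndimers r c.+1 h v + (maxn r c).+1 + r.
Proof.
move=> B E; have := B _ _ (edges_behead E).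
by rewrite ndimers_shift mulnS; lia.
Qed.

(** Otherwise delete the left column and the top row. Since [k.+1] is odd, [side_ge] gives at least
    [k] for twice the number of dimers on each, and the bound for the remaining square refutes
    [big]. *)
Lemma corner_covered k h v : ~~ odd k -> dimer_bound k k -> edges k.+1 k.+1 h v ->
  2 * ndimers k.+1 k.+1 h v + k.+2 < k.+1 * k.+1 -> h 0 0 || v 0 0.
Proof.
move=> ev B E big; apply/negPn/negP; rewrite negb_or => /andP[/negbTE h0 /negbTE v0].
have E1 := edges_behead E.
have := B _ _ (edges_behead (edges_tr E1)).
move: big; rewrite ndimers_shift -[ndimers k.+1 k _ _]ndimers_tr ndimers_shift.
have := side_ge E (leqnn _); have := side_ge (edges_tr E) (leqnn _).
(* As the corner is a monomer, no dimer meets both the left column and the top row, so none is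
   counted twice. *)
have -> : side k.+1 (tr v) (tr h) = side k (tr (fun x y => v x y.+1)) (tr (fun x y => h x y.+1)).
  by rewrite /side big_ord_recl /tr h0 v0.
rewrite maxnn mulnS mulSn.
set s := side _ _ _; set s' := side _ _ _; rewrite /=.
set n1 := ndimers _ _ _ _; lia.
Qed.

(** The vertical dimer in the corner is the first letter of the top side, so monomers can prevail
    there only through a vee, and this excludes a vee on the left. *)
Lemma no_vertical_corner n h v : odd n -> edges n n h v ->
  2 * side n h v < n -> 2 * side n (tr v) (tr h) < n ->
  v 0 0 -> h n.-1 0 || v n.-2 0 -> False.
Proof.
move=> od E s1 s2 v0 corner; have n1 : 1 < n by case: (v_dom E v0).
have [p [q W]] : exists p q, vee n (tr v) (tr h) p q.
  case: (vee_or_monomer_ends (edges_tr E) s2) => // -[[j [jn Mj first]] _].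
  case: (posnP j) => [j0|jp]; first by case/and3P: Mj => /negP[]; rewrite j0.
  by have /andP[_ /negP[]] := first 0 jp.
have [q_n [pq _ _ _]] := W.
case: (vee_or_monomer_ends E s1) => [[i [j V]]|[[j [jn Mj first]] [i [i_n Mi last]]]].
  have [jn [ij _ _ _]] := V.
  by apply: (no_adjacent_vees E V W); lia.
have ir : i.+1 < n.
  rewrite ltn_neqAle i_n andbT; apply/eqP => e.
  case/and3P: Mi => /negP hi _ /negP vi; case/orP: corner => X.
    by apply: hi; have -> : i = n.-1 by lia.
  by apply: vi; apply/andP; split; [lia | have -> : i.-1 = n.-2 by lia].
have ji : j <= i.
  rewrite leqNgt; apply/negP => l; have /first/andP[/negP[]] // : i < j by [].
case: j jn Mj first ji => [|j] jn Mj first ji; first by case/and3P: Mj => _ /negP.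
(* The cells above the first monomer and those below the last one pair up. As [n] is odd, both
   monomers lie in even rows, against [ray_parity]; they may coincide. *)
have evj : ~~ odd j.+1.
  apply/negP => oj; have V : v j 0.
    by apply: (@vertical_run n n h v E 0 j.+1) => //; rewrite subn0.
  by case/and3P: Mj => _ _ /negP[].
have evi : ~~ odd i.
  apply/negP => oi; have V : v n.-1 0.
    apply: (@vertical_run n n h v E i.+1 n) => //; last lia.
    by move=> _; case/and3P: Mi.
  by case: (v_dom E V); lia.
have /andP[_ hj] := first j (leqnn _).
have /andP[_ hi] := last i.+1 ltac:(lia).
have := ray_parity E (leqnn n) Mj hj Mi ir hi ji.
lia.
Qed.

(** [side_lt] and [corner] are stated for every tiling with as many dimers as the counterexample, so
    that they apply to its reflections and transposes. *)
Lemma odd_square_bound k : ~~ odd k -> dimer_bound k k -> dimer_bound k.+1 k ->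
  dimer_bound k.+1 k.+1.
Proof.
move=> ev Bkk Bk h v E; rewrite leqNgt maxnn; apply/negP => big.
have side_lt h' v' : edges k.+1 k.+1 h' v' -> ndimers k.+1 k.+1 h' v' = ndimers k.+1 k.+1 h v ->
    2 * side k.+1 h' v' < k.+1.
  move=> E' e; have := drop_column Bk E'; rewrite e.
  have -> : maxn k.+1 k = k.+1 by lia.
  lia.
have corner h' v' : edges k.+1 k.+1 h' v' -> ndimers k.+1 k.+1 h' v' = ndimers k.+1 k.+1 h v ->
    h' 0 0 || v' 0 0.
  by move=> E' e; apply: (corner_covered ev Bkk E'); rewrite e; lia.
have main h' v' : edges k.+1 k.+1 h' v' -> ndimers k.+1 k.+1 h' v' = ndimers k.+1 k.+1 h v ->
    v' 0 0 -> False.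
  move=> E' e v0; have kp : 0 < k by case: (v_dom E' v0).
  have e' : ndimers k.+1 k.+1 (tr v') (tr h') = ndimers k.+1 k.+1 h v by rewrite ndimers_tr.
  have Et := edges_tr E'.
  apply: (no_vertical_corner _ E' (side_lt _ _ E' e) (side_lt _ _ Et e') v0) => //=.
  (* Transposing and then reflecting brings the bottom left corner to the top left. *)
  have := corner _ _ (edges_flip Et).
  rewrite (ndimers_flip Et) => /(_ e'); rewrite /flip_h /flip_v /tr /= !subn0.
  by case: k {ev Bkk Bk E big side_lt corner E' e e' Et} kp => //= k _; rewrite orbC.
have := corner _ _ E erefl; case/orP => [h0|v0]; last exact: (main _ _ E erefl v0).
by apply: (main _ _ (edges_tr E) _ h0); rewrite ndimers_tr.
Qed.

(** In a counterexample, deleting a side loses some monomers; the side being even, it loses at least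
    two, hence [vee_of_side] applies to the left, right and top sides. *)
Lemma even_bound r c : 0 < r -> r <= c -> c < r.*2 -> ~~ odd r -> ~~ odd c ->
  (forall r' c', r' + c' < r + c -> dimer_bound r' c') -> dimer_bound r c.
Proof.
move=> r0 rc c2 er ec IH h v E.
have drop r1 c1 h' v' : maxn r1 c1 = c -> r1 + c1 = r + c -> edges r1 c1 h' v' -> 0 < c1 -> ~~ odd r1 ->
    r1 * c1 <= 2 * ndimers r1 c1 h' v' + c.+1 \/ exists i j, vee r1 h' v' i j.
  move=> mx sm E' c0 e1; case: c1 c0 mx sm E' => // c1 _ mx sm E'.
  have B : dimer_bound r1 c1 by apply: IH; lia.
  have := drop_column B E'.
  case: (ltnP (2 * side r1 h' v') r1) => [lt _|ge]; last by left; lia.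
  by right; apply: (vee_of_side E'); lia.
have mx : maxn r c = c by lia. have mx' : maxn c r = c by lia.
rewrite mx; have [||//|[i [j V]]] := drop r c h v mx erefl E; [lia|lia|].
have Ef := edges_flip E.
have [|||[i' [j' V']]] := drop r c _ _ mx erefl Ef; [lia|lia| |].
  by rewrite (ndimers_flip E).
have [|||[p [q W]]] := drop c r _ _ mx' (addnC c r) (edges_tr E); [lia|lia| |].
  by rewrite ndimers_tr mulnC.
have [jr [ij _ _ _]] := V; have [jr' [ij' _ _ _]] := V'; have [qc [pq _ _ _]] := W.
case: (ltnP p r) => pr.
  by case: (no_adjacent_vees E V W); lia.
(* Here [r <= p], and [c < r.*2] puts the start [c.-1 - q] of the reflected top vee below [r]. *)
by case: (no_adjacent_vees Ef V' (vee_flip E W)); lia.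
Qed.

(** All dimensions are even, so parity improves the bound by one in each of the two parts; the
    improved bounds add up. *)
Lemma long_even_bound r d : ~~ odd r -> ~~ odd d -> r <= d ->
  dimer_bound r r -> dimer_bound r d -> dimer_bound r (r + d).
Proof.
move=> er ed rd B1 B2 h v E.
have := B1 _ _ (edges_trunc E); have := B2 _ _ (edges_shift E).
have := ndimers_cut r d r h v.
set n := ndimers _ _ _ _; set n1 := ndimers _ _ _ _; set n2 := ndimers _ _ _ _.
have := @oddM r r; have := @oddM r d; rewrite mulnDr.
by set a := r * r; set b := r * d; lia.
Qed.

Lemma all_dimer_bound r c : dimer_bound r c.
Proof.
have [n] := ubnP (r + c); elim: n r c => // n IHn r c rcn.
wlog rc : r c rcn / r <= c.
  move=> W; case: (leqP r c) => [|/ltnW] l; first exact: W.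
  by apply: dimer_bound_tr; apply: W => //; rewrite addnC.
have IH r' c' : r' + c' < r + c -> dimer_bound r' c' by move=> l; apply: IHn; lia.
case: (posnP r) => [-> h v _ //|r0].
case er : (odd r).
  case: (eqVneq r c) => [e|ne].
    case: r er r0 rc rcn e IH => // k ek _ _ _ <- IH.
    by apply: odd_square_bound => //; apply: IH; lia.
  (* For odd [r], [side_ge] improves by parity to a loss of at most 1, which the growth of the
     maximum from [c] to [c.+1] absorbs. *)
  case: c rc rcn ne IH => [|c] rc rcn ne IH h v E; first lia.
  have B : dimer_bound r c by apply: IH; lia.
  have := drop_column B E; have := side_ge E rc.
  have -> : maxn r c = c by lia. have -> : maxn r c.+1 = c.+1 by lia.
  by lia.
case ec : (odd c).
  (* Now [r] and the new [c] are even, so the bound for the smaller grid improves by one; together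
     with the growth of the maximum this absorbs a loss of 2. *)
  case: c rc rcn ec IH => [//|c] rc rcn ec IH h v E.
  have B : dimer_bound r c by apply: IH; lia.
  have := B _ _ (edges_behead E); have := side_ge E rc.
  rewrite ndimers_shift mulnS.
  have -> : maxn r c = c by lia. have -> : maxn r c.+1 = c.+1 by lia.
  have := @oddM r c; rewrite er /=.
  set s := side _ _ _; set a := ndimers _ _ _ _.
  by set m := r * c; lia.
case: (ltnP c r.*2) => c2; first by apply: even_bound => //; rewrite ?er ?ec.
have -> : c = r + (c - r) by lia.
by apply: long_even_bound; try (apply: IH); lia.
Qed.

(** * From set partitions to dimers *)

Lemma sum_pred_shift (f : nat -> bool) n : (forall j, f j -> j.+1 < n) ->
  \sum_(j < n) ((0 < j) && f j.-1) = \sum_(j < n) f j.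
Proof.
case: n => [|n] H; first by rewrite !big_ord0.
rewrite big_ord_recl big_ord_recr /=.
by rewrite (_ : f n = false) ?addn0 //; apply/negP => /H; rewrite ltnn.
Qed.

Section Tiling.
Variables r c : nat.

Definition pos (a : cell r c) : nat * nat := (nat_of_ord a.1, nat_of_ord a.2).

Lemma pos_inj : injective pos.
Proof. by case=> [i j] [i' j'] [/val_inj -> /val_inj ->]. Qed.

Variable P : {set {set cell r c}}.

(** The existential form makes this total on natural coordinates and false as soon as a position
    lies outside the grid. *)
Definition same_tile (p q : nat * nat) :=
  [exists a : cell r c, exists b : cell r c,
     [&& pos a == p, pos b == q & pblock P a == pblock P b]].
Definition tile_h x y := same_tile (x, y) (x, y.+1).
Definition tile_v x y := same_tile (x, y) (x.+1, y).

Lemma same_tileP (p q : nat * nat) :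
  reflect (exists a b, [/\ pos a = p, pos b = q & pblock P a = pblock P b])
          (same_tile p q).
Proof.
apply: (iffP existsP) => [[a /existsP[b /and3P[/eqP ? /eqP ? /eqP ?]]]|[a [b [<- <- e]]]].
  by exists a, b.
by exists a; apply/existsP; exists b; rewrite !eqxx e eqxx.
Qed.

Lemma same_tile_pos a b : same_tile (pos a) (pos b) = (pblock P a == pblock P b).
Proof.
apply/same_tileP/eqP => [[a' [b' [/pos_inj -> /pos_inj ->]]] //|e].
by exists a, b.
Qed.

Lemma same_tile_sym p q : same_tile p q -> same_tile q p.
Proof. by case/same_tileP => a [b [? ? ?]]; apply/same_tileP; exists b, a. Qed.

Hypothesis tP : tiling P.

Let partP : partition P [set: cell r c]. Proof. by case/andP: tP. Qed.
Let trivP : trivIset P. Proof. by case/and3P: partP. Qed.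
Let in_cover (a : cell r c) : a \in cover P.
Proof. by rewrite (cover_partition partP) inE. Qed.

Lemma tile_pair (a b : cell r c) : a != b -> pblock P a = pblock P b ->
  pblock P a = [set a; b] /\ adjacent a b.
Proof.
move=> ne e; have tile : is_tile (pblock P a).
  by case/andP: tP => _ /forall_inP; apply; rewrite pblock_mem.
have aB : a \in pblock P a by rewrite mem_pblock.
have bB : b \in pblock P a by rewrite e mem_pblock.
case/orP: tile => [/cards1P[z ez]|].
  by case/eqP: ne; move: aB bB; rewrite ez !inE => /eqP -> /eqP ->.
case/existsP => x /existsP[y /andP[adj /eqP exy]]; move: aB bB; rewrite exy !inE.
case/orP=> /eqP ea /orP[] /eqP eb; move: ne; rewrite ea eb ?eqxx //= => _.
by rewrite setUC; split=> //; move: adj; rewrite /adjacent; lia.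
Qed.

Lemma same_tile3 p q s : same_tile p q -> same_tile q s ->
  p != q -> q != s -> p != s -> False.
Proof.
case/same_tileP => a [b [<- <- eab]] /same_tileP [b' [d [/pos_inj -> <- ebd]]].
rewrite !(inj_eq pos_inj) => ab bd ad.
have [Bab _] := tile_pair ab eab.
have : d \in pblock P a by rewrite eab ebd mem_pblock.
by rewrite Bab !inE ![d == _]eq_sym (negbTE bd) (negbTE ad).
Qed.

Lemma edges_of_tiling : tatami_cond P -> edges r c tile_h tile_v.
Proof.
move=> cond; split=> x y.
- by case/same_tileP => a [b [[<- _] [_ <-] _]]; split; apply: ltn_ord.
- by case/same_tileP => a [b [[_ <-] [<- _] _]]; split; apply: ltn_ord.
- by move=> H1 H2; apply: (same_tile3 H1 H2); rewrite xpair_eqE; lia.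
- by move=> H1 H2; apply: (same_tile3 H1 H2); rewrite xpair_eqE; lia.
- by move=> /same_tile_sym H1 H2; apply: (same_tile3 H1 H2); rewrite xpair_eqE; lia.
- by move=> H1 H2; apply: (same_tile3 H1 H2); rewrite xpair_eqE; lia.
- by move=> H1 H2; apply: (same_tile3 H2 H1); rewrite xpair_eqE; lia.
- by move=> H1 /same_tile_sym H2; apply: (same_tile3 H1 H2); rewrite xpair_eqE; lia.
move=> xr yc; pose a : cell r c := (Ordinal (ltnW xr), Ordinal (ltnW yc)).
pose b : cell r c := (Ordinal xr, Ordinal yc).
move/forallP: cond => /(_ a) /forallP /(_ b); rewrite /= !eqxx /= !inE.
(* Two of the four blocks coincide. The four pairs of neighbours give the four covers; the two
   diagonal pairs are not adjacent, so they cannot form a tile. *)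
rewrite !negb_and !negbK orbF => /orP[/or3P[]|/orP[/orP[]|]] e.
- by constructor 1; rewrite /tile_h -[(x, y)]/(pos a) -[(x, y.+1)]/(pos (a.1, b.2)) same_tile_pos.
- by constructor 3; rewrite /tile_v -[(x, y)]/(pos a) -[(x.+1, y)]/(pos (b.1, a.2)) same_tile_pos.
- have ne : a != b by apply/eqP => -[]; lia.
  by have [_] := tile_pair ne (eqP e); rewrite /adjacent /=; lia.
- have ne : (a.1, b.2) != (b.1, a.2) by apply/eqP => -[]; lia.
  by have [_] := tile_pair ne (eqP e); rewrite /adjacent /=; lia.
- by constructor 4; rewrite /tile_v -[(x, y.+1)]/(pos (a.1, b.2)) -[(x.+1, y.+1)]/(pos b) same_tile_pos.
- by constructor 2; rewrite /tile_h -[(x.+1, y)]/(pos (b.1, a.2)) -[(x.+1, y.+1)]/(pos b) same_tile_pos.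
Qed.

Lemma num_monomersE : num_monomers P = \sum_(a : cell r c) ([set a] \in P).
Proof.
rewrite /num_monomers.
have -> : [set B in P | monomer B] = [set [set a] | a in [set a : cell r c | [set a] \in P]].
  apply/setP => B; rewrite inE; apply/andP/imsetP => [[BP /cards1P[a e]]|[a]].
    by exists a => //; rewrite inE -e.
  by rewrite inE => aP ->; split=> //; rewrite /monomer cards1.
rewrite card_imset; last exact: set1_inj.
by rewrite -sum1_card big_mkcond; apply: eq_bigr => a _; rewrite inE; case: (_ \in P).
Qed.

(** The tile of [a] is a monomer or a dimer going right, down, left or up. The positivity guards
    matter because [0.-1] is [0]. *)
Lemma cell_covered_once (a : cell r c) : tatami_cond P ->
  ([set a] \in P) + (tile_h a.1 a.2 + tile_v a.1 a.2 +
    (((0 < a.2) && tile_h a.1 a.2.-1) + ((0 < a.1) && tile_v a.1.-1 a.2))) = 1.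
Proof.
move=> cond; have E := edges_of_tiling cond.
have aB : a \in pblock P a by rewrite mem_pblock.
have alone b : [set a] \in P -> pblock P a = pblock P b -> b = a.
  move=> aP e; have : b \in pblock P a by rewrite e mem_pblock.
  by rewrite (def_pblock trivP aP (set11 a)) inE => /eqP.
have alone2 p : p != pos a -> [set a] \in P -> same_tile (pos a) p -> False.
  move=> ne aP /same_tileP[a' [b [/pos_inj -> e eB]]]; case/eqP: ne.
  by rewrite -e (alone b aP eB).
have left_cell : 0 < a.2 -> nat_of_ord a.2 = a.2.-1.+1 by move/prednK.
have up_cell : 0 < a.1 -> nat_of_ord a.1 = a.1.-1.+1 by move/prednK.
have next n : n.+1 != n by rewrite eqn_leq ltnn.
have prev n : 0 < n -> n.-1 != n by case: n => // n _; rewrite eq_sym next.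
have exist : [|| [set a] \in P, tile_h a.1 a.2, tile_v a.1 a.2,
    (0 < a.2) && tile_h a.1 a.2.-1 | (0 < a.1) && tile_v a.1.-1 a.2].
  case: (boolP ([set a] \in P)) => //= aNP.
  have [b ab eB] : exists2 b, a != b & pblock P a = pblock P b.
    have BP : pblock P a \in P by rewrite pblock_mem.
    case/andP: tP => _ /forall_inP /(_ _ BP) /orP[/cards1P[z ez]|].
      by case/negP: aNP; move: aB BP; rewrite ez inE => /eqP ->.
    case/existsP => x /existsP[y /andP[adj /eqP exy]].
    have xy : x != y by apply/eqP => e; move: adj; rewrite e /adjacent; lia.
    have mem b : b \in pblock P a -> pblock P a = pblock P b by move/(same_pblock trivP).
    have : a \in [set x; y] by rewrite -exy.
    rewrite !inE => /orP[]/eqP ea; [exists y | exists x].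
    - by rewrite ea.
    - by apply: mem; rewrite exy !inE eqxx orbT.
    - by rewrite ea eq_sym.
    - by apply: mem; rewrite exy !inE eqxx.
  have [_ adj] := tile_pair ab eB.
  have st : same_tile (pos a) (pos b) by rewrite same_tile_pos eB.
  have ts := same_tile_sym st; move: st ts adj; rewrite /pos /adjacent /tile_h /tile_v.
  move=> st ts /orP[]/andP[/eqP e /orP[]/eqP e'].
  - by rewrite -e -e' in st; rewrite st.
  - by rewrite e -e' in ts *; rewrite ts !orbT.
  - by rewrite -e -e' in st; rewrite st !orbT.
  - by rewrite e -e' in ts *; rewrite ts !orbT.
have N1 x y : (x && y -> False) -> ~~ (x && y) by move=> H; apply/negP.
(* One of the five cases holds by [exist]; it remains to exclude every pair of them. *)
pose s := [set a] \in P; pose h1 := tile_h a.1 a.2; pose v1 := tile_v a.1 a.2.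
pose h2 := (0 < a.2) && tile_h a.1 a.2.-1; pose v2 := (0 < a.1) && tile_v a.1.-1 a.2.
have sh1 : ~~ (s && h1).
  by apply: N1 => /andP[aP]; apply: alone2; rewrite // /pos xpair_eqE negb_and ?next ?prev ?orbT.
have sv1 : ~~ (s && v1).
  by apply: N1 => /andP[aP]; apply: alone2; rewrite // /pos xpair_eqE negb_and ?next ?prev ?orbT.
have sh2 : ~~ (s && h2).
  apply: N1 => /and3P[aP l]; rewrite /tile_h -left_cell // => /same_tile_sym.
  by apply: alone2; rewrite // /pos xpair_eqE negb_and ?next ?prev ?orbT.
have sv2 : ~~ (s && v2).
  apply: N1 => /and3P[aP l]; rewrite /tile_v -up_cell // => /same_tile_sym.
  by apply: alone2; rewrite // /pos xpair_eqE negb_and ?next ?prev ?orbT.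
have hv11 : ~~ (h1 && v1) by apply: N1 => /andP[H V]; exact: (hv_disj00 E H V).
have hh : ~~ (h1 && h2).
  apply: N1 => /and3P[H l H']; apply: (hh_disj E H'); rewrite -left_cell //.
have hv12 : ~~ (h1 && v2).
  apply: N1 => /and3P[H l V]; apply: (hv_disj10 E _ V); rewrite -up_cell //.
have hv21 : ~~ (h2 && v1).
  apply: N1 => /andP[/andP[l H] V]; apply: (hv_disj01 E H); rewrite -left_cell //.
have hv22 : ~~ (h2 && v2).
  apply: N1 => /and3P[/andP[l H] u V].
  by apply: (@hv_disj11 _ _ _ _ E a.1.-1 a.2.-1); rewrite -?up_cell -?left_cell.
have vv : ~~ (v1 && v2).
  apply: N1 => /and3P[V l V']; apply: (vv_disj E V'); rewrite -up_cell //.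
move: exist sh1 sv1 sh2 sv2 hv11 hh hv12 hv21 hv22 vv.
rewrite -/s -/h1 -/v1 -/h2 -/v2.
by case: s; case: h1; case: v1; case: h2; case: v2.
Qed.

Lemma num_monomers_dimers : tatami_cond P ->
  num_monomers P + 2 * ndimers r c tile_h tile_v = r * c.
Proof.
move=> cond; have E := edges_of_tiling cond.
have <- : \sum_(a : cell r c) 1 = r * c by rewrite sum1_card card_prod !card_ord.
rewrite -(eq_bigr _ (fun a _ => cell_covered_once a cond)) big_split -num_monomersE /=.
(* Each dimer is counted once at its left or upper cell and once at its right or lower cell;
   [sum_pred_shift] reindexes the second count. *)
congr (_ + _); rewrite big_split /= mul2n -addnn; congr (_ + _); rewrite /ndimers.
  by rewrite pair_big.
rewrite big_split /=.
under eq_bigr => x _ do rewrite big_split.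
rewrite big_split /=; congr (_ + _).
  rewrite -(pair_bigA _ (fun (x : 'I_r) (y : 'I_c) => nat_of_bool ((0 < y) && tile_h x y.-1))) /=.
  by apply: eq_bigr => x _; rewrite sum_pred_shift // => j /(h_dom E) [].
rewrite -(pair_bigA _ (fun (x : 'I_r) (y : 'I_c) => nat_of_bool ((0 < x) && tile_v x.-1 y))) /=.
rewrite exchange_big [RHS]exchange_big /=.
by apply: eq_bigr => y _; rewrite (@sum_pred_shift (tile_v^~ y)) // => j /(v_dom E) [].
Qed.
End Tiling.

Theorem theorem1 (r c m : nat) :
  1 <= r -> 1 <= c -> 0 < T r c m ->
  m = r * c %[mod 2] /\ m <= maxn r.+1 c.+1.
Proof.
move=> _ _ /card_gt0P[P]; rewrite inE => /andP[/andP[tP cond] /eqP <-].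
have e := num_monomers_dimers tP cond.
have := all_dimer_bound (edges_of_tiling tP cond).
by rewrite -e; lia.
Qed.
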